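(* Let $LB$ be a lower bound on the optimal objective function value of the discrete $\alpha$-neighbor $p$-center problem. Then $$u_k=1\quad\forall k\in\{2,\dots,K\} \text{ with } d_k\le LB$$ are valid equalities for the formulation (APC2), i.e., when adding them to (APC2), the set of feasible solutions does not change.
   Context: Discrete $\alpha$-neighbor $p$-center problem (d-$\alpha$-$p$CP): given are a finite set of points $N$, a positive integer $p<|N|$, a positive integer $\alpha\le p$, and distances $d_{ij}\ge 0$ for $i,j\in N$. A feasible solution is a set $P\subseteq N$ with $|P|=p$ (open facilities). For $i\in N\setminus P$ let $d_\alpha(P,i)=\min_{A\subseteq P,|A|=\alpha}\max_{j\in A} d_{ij}$, and let $f_\alpha(P)=\max_{i\in N\setminus P} d_\alpha(P,i)$ be the objective function value of $P$. The problem is $\min_{P\subseteq N,|P|=p} f_\alpha(P)$. Let $D=\{d_{ij}: i,j\in N, i\ne j\}=\{d_1,\dots,d_K\}$ with $d_1<d_2<\dots<d_K$, and for $i\in N$ let $D_i=\{d_{ij}: j\in N\setminus\{i\}\}\setminus\{d_1\}$. Formulation (APC2), in variables $u_k$ ($k=2,\dots,K$) and $y_j$ ($j\in N$): minimize $d_1+\sum_{k=2}^K(d_k-d_{k-1})u_k$ subject to - $\sum_{j\in N}y_j=p$; - $u_{k-1}\ge u_k$ for all $k\in\{3,\dots,K\}$; - $\alpha u_k+\sum_{j\in N\setminus\{i\}: d_{ij}<d_k} y_j\ge \alpha(1-y_i)$ for all $i\in N$ and all $d_k\in D_i$; - $u_k\in\{0,1\}$ for all $k\in\{2,\dots,K\}$;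 $y_j\in\{0,1\}$ for all $j\in N$. *)

(* Defs.v *)
From mathcomp Require Import all_boot all_order all_algebra.
Set Implicit Arguments.
Unset Strict Implicit.
Unset Printing Implicit Defensive.
Import Order.TTheory GRing.Theory Num.Theory.
Local Open Scope ring_scope.

(* Starting the iteration from the head makes these the true minimum and
   maximum of any nonempty sequence; both are 0 on [::]. *)
Definition seq_min (R : realFieldType) (s : seq R) : R :=
  \big[Num.min/head 0 s]_(x <- s) x.

Definition seq_max (R : realFieldType) (s : seq R) : R :=
  \big[Num.max/head 0 s]_(x <- s) x.

Definition d_alpha (R : realFieldType) (N : finType) (d : N -> N -> R)
    (alpha : nat) (P : {set N}) (i : N) : R :=
  seq_min [seq seq_max [seq d i j | j in A]
          | A : {set N} in [set A : {set N} | A \subset P & #|A| == alpha]].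

Definition f_alpha (R : realFieldType) (N : finType) (d : N -> N -> R)
    (alpha : nat) (P : {set N}) : R :=
  seq_max [seq d_alpha d alpha P i | i in ~: P].

Definition opt_value (R : realFieldType) (N : finType) (d : N -> N -> R)
    (p alpha : nat) : R :=
  seq_min [seq f_alpha d alpha P
          | P : {set N} in [set P : {set N} | #|P| == p]].

(* The set D, listed in increasing order without repetition; the diagonal
   entries d i i do not contribute. *)
Definition dists (R : realFieldType) (N : finType) (d : N -> N -> R) : seq R :=
  sort <=%R (undup [seq d ij.1 ij.2 | ij : N * N in [pred ij | ij.1 != ij.2]]).

Definition ndists (R : realFieldType) (N : finType) (d : N -> N -> R) : nat :=
  size (dists d).

(* d_k, with k counted from 1 as in d_1 < ... < d_K. *)
Definition dist (R : realFieldType) (N : finType) (d : N -> N -> R)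
    (k : nat) : R :=
  nth 0 (dists d) k.-1.

(* The index set {2, ..., K} of the variables u_k. *)
Definition level (R : realFieldType) (N : finType) (d : N -> N -> R) :=
  {k : 'I_(ndists d).+1 | (1 < k)%N}.

Definition level_nat (R : realFieldType) (N : finType) (d : N -> N -> R)
    (k : level d) : nat := val (val k).

Definition dists_from (R : realFieldType) (N : finType) (d : N -> N -> R)
    (i : N) : pred R :=
  [pred x | (x \in [seq d i j | j in [pred j | j != i]]) && (x != dist d 1)].

Definition apc2_objective (R : realFieldType) (N : finType) (d : N -> N -> R)
    (u : {ffun level d -> R}) : R :=
  dist d 1
  + \sum_(k : level d)
      (dist d (level_nat k) - dist d (level_nat k).-1) * u k.

(* In the second constraint l plays the role of k - 1, so k ranges over
   {3, ..., K}. *)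
Definition apc2_feasible (R : realFieldType) (N : finType) (d : N -> N -> R)
    (p alpha : nat) (u : {ffun level d -> R}) (y : {ffun N -> R}) : Prop :=
  [/\ \sum_(j : N) y j = p%:R,
      forall l k : level d, level_nat k = (level_nat l).+1 -> u k <= u l,
      forall (i : N) (k : level d), dist d (level_nat k) \in dists_from d i ->
        alpha%:R * (1 - y i)
        <= alpha%:R * u k
           + \sum_(j : N | (j != i) && (d i j < dist d (level_nat k))) y j,
      forall k : level d, u k = 0 \/ u k = 1
    & forall j : N, y j = 0 \/ y j = 1].

(* Main.v *)
Require Import Defs.
From mathcomp Require Import all_boot all_order all_algebra.
Set Implicit Arguments.
Unset Strict Implicit.
Unset Printing Implicit Defensive.
Import Order.TTheory GRing.Theory Num.Theory.
Local Open Scope ring_scope.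

(** Let (u, y) be feasible and let P be the set of facilities opened by y, so
    that P has p elements and f_alpha(P) is at least the optimal value, hence
    at least LB.  If d_k <= LB, some customer i outside P attains f_alpha(P),
    and d_alpha(P, i) is then at least d_k.  The value d_alpha(P, i) is itself
    a distance d_ij with j in P ([d_alpha_attained]), so it equals some d_m of
    D_i, and m >= k because the d's increase.  Fewer than alpha
    facilities of P are strictly closer to i than d_alpha(P, i)
    ([card_closer_lt_alpha]), so the covering constraint at (i, m) forces
    u_m = 1, and monotonicity of u gives u_k = 1.

    The detour through m is what makes the argument work: d_k need not belong
    to D_i, in which case there is no covering constraint at (i, k). *)

Section SeqExtrema.
Variable R : realFieldType.
Implicit Types s : seq R.

Lemma seq_max_mem s : s != [::] -> seq_max s \in s.
Proof.
case: s => // a s _; rewrite /seq_max /= big_seq.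
elim/big_ind: _ => [|x y|x //]; first exact: mem_head.
by rewrite /Num.max; case: ifP.
Qed.

Lemma seq_min_mem s : s != [::] -> seq_min s \in s.
Proof.
case: s => // a s _; rewrite /seq_min /= big_seq.
elim/big_ind: _ => [|x y|x //]; first exact: mem_head.
by rewrite /Num.min; case: ifP.
Qed.

Lemma seq_min_le s x : x \in s -> seq_min s <= x.
Proof.
rewrite /seq_min; move: (head 0 s) => h.
elim: s => // a s IHs; rewrite inE big_cons ge_min => /orP[/eqP->|/IHs->].
  by rewrite lexx.
by rewrite orbT.
Qed.

End SeqExtrema.

Lemma image_neq0 (T : finType) (S : eqType) (f : T -> S) (A : {pred T}) x :
  x \in A -> [seq f y | y in A] != [::].
Proof. by move=> Ax; apply/eqP=> A0; have := image_f f Ax; rewrite A0. Qed.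

Lemma card_subset_exists (T : finType) (B : {set T}) n :
  (n <= #|B|)%N -> exists2 A : {set T}, A \subset B & #|A| = n.
Proof.
move=> le_nB; have : (0 < #|[set A : {set T} | A \subset B & #|A| == n]|)%N.
  by rewrite cards_draws bin_gt0.
by case/card_gt0P=> A; rewrite inE => /andP[sAB /eqP cA]; exists A.
Qed.

Section AlphaNeighbor.
Variables (R : realFieldType) (N : finType) (d : N -> N -> R).
Variables (alpha : nat) (P : {set N}).
Hypothesis alpha_gt0 : (0 < alpha)%N.

Lemma seq_max_dist_attained (A : {set N}) i :
  #|A| = alpha -> exists2 j, j \in A & seq_max [seq d i j | j in A] = d i j.
Proof.
move=> cA; have /card_gt0P[a Aa] : (0 < #|A|)%N by rewrite cA.
by have /imageP[j Aj ->] := seq_max_mem (image_neq0 (d i) Aa); exists j.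
Qed.

Lemma d_alpha_attained i :
  (alpha <= #|P|)%N -> exists2 j, j \in P & d_alpha d alpha P i = d i j.
Proof.
case/card_subset_exists=> A sAP cA.
have AP : A \in [set A : {set N} | A \subset P & #|A| == alpha].
  by rewrite inE sAP cA eqxx.
have /imageP[B] := seq_min_mem
  (image_neq0 (fun A : {set N} => seq_max [seq d i j | j in A]) AP).
rewrite inE => /andP[sBP /eqP cB]; rewrite -/(d_alpha d alpha P i) => ->.
have [j Bj ->] := seq_max_dist_attained i cB.
by exists j => //; apply: (subsetP sBP).
Qed.

(** Otherwise alpha of these facilities would form a set whose farthest
    member beats the minimum defining d_alpha. *)
Lemma card_closer_lt_alpha i :
  (#|[set j in P | (d i j < d_alpha d alpha P i)%R]| < alpha)%N.
Proof.
rewrite ltnNge; apply/negP=> /card_subset_exists[A sA cA].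
have [j Aj maxA] := seq_max_dist_attained i cA.
have := subsetP sA j Aj; rewrite inE ltNge => /andP[_ /negP[]].
rewrite -maxA; apply: seq_min_le.
apply: (image_f (fun A : {set N} => seq_max [seq d i j | j in A])).
rewrite inE cA eqxx andbT; apply: subset_trans sA _.
by apply/subsetP=> x; rewrite inE => /andP[].
Qed.

Lemma f_alpha_attained :
  (#|P| < #|N|)%N ->
  exists2 i, i \notin P & f_alpha d alpha P = d_alpha d alpha P i.
Proof.
rewrite -(cardsC P) -{1}[#|P|]addn0 ltn_add2l => /card_gt0P[a Pa].
have /imageP[i iP fE] := seq_max_mem (image_neq0 (d_alpha d alpha P) Pa).
by exists i => //; rewrite -in_setC.
Qed.

End AlphaNeighbor.

Section Distances.
Variables (R : realFieldType) (N : finType) (d : N -> N -> R).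

Lemma dists_sorted : sorted <%R (dists d).
Proof.
by rewrite lt_sorted_uniq_le sort_uniq undup_uniq (sort_sorted (@le_total _ R)).
Qed.

Lemma mem_dists i j : i != j -> d i j \in dists d.
Proof.
move=> ij; rewrite mem_sort mem_undup.
by apply: (image_f (fun ij : N * N => d ij.1 ij.2) (x := (i, j))).
Qed.

Lemma dist_le (k l : nat) : (0 < k <= ndists d)%N -> (0 < l <= ndists d)%N ->
  (dist d k <= dist d l) = (k <= l)%N.
Proof.
case: k l => [|k] [|l] //= hk hl.
by rewrite /dist (lt_sorted_leq_nth 0 dists_sorted).
Qed.

Lemma level_bounds (k : level d) : (1 < level_nat k <= ndists d)%N.
Proof. by case: k => [[k hk] k1]; rewrite /level_nat /= k1 -ltnS. Qed.

Lemma level_exists k :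
  (1 < k <= ndists d)%N -> exists l : level d, level_nat l = k.
Proof.
case/andP=> k1; rewrite -ltnS => hk.
by exists (exist (fun k : 'I_(ndists d).+1 => (1 < k)%N) (Ordinal hk) k1).
Qed.

Lemma dist_attained i j : i != j ->
  exists2 m, (0 < m <= ndists d)%N & dist d m = d i j.
Proof.
move=> /mem_dists dij; exists (index (d i j) (dists d)).+1.
  by rewrite /= index_mem.
by rewrite /dist /= nth_index.
Qed.

End Distances.

Section Feasible.
Variables (R : realFieldType) (N : finType) (d : N -> N -> R).
Variables (p alpha : nat) (u : {ffun level d -> R}) (y : {ffun N -> R}).
Hypothesis feas : apc2_feasible p alpha u y.

Definition opened : {set N} := [set j | y j == 1].

Lemma y_opened j : y j = (j \in opened)%:R.
Proof.
case: feas => _ _ _ _ /(_ j)[] yj; rewrite inE yj ?eqxx //.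
by rewrite eq_sym oner_eq0.
Qed.

Lemma sum_opened (Q : pred N) :
  \sum_(j | Q j) y j = #|[set j in opened | Q j]|%:R.
Proof.
rewrite -sum1_card natr_sum big_mkcond [RHS]big_mkcond /=.
apply: eq_bigr => j _; rewrite y_opened in_set.
by case: (j \in opened); case: (Q j).
Qed.

Lemma card_opened : #|opened| = p.
Proof.
case: feas => + _ _ _ _; rewrite sum_opened => /eqP; rewrite eqr_nat => /eqP <-.
by apply: eq_card => j; rewrite !inE andbT.
Qed.

Lemma u_nonincreasing (k l : level d) :
  (level_nat k <= level_nat l)%N -> u l <= u k.
Proof.
move nE: (level_nat l) => n; elim: n l nE => [|n IHn] l nE.
  by have := level_bounds l; rewrite nE.
rewrite leq_eqVlt ltnS => /orP[/eqP kE|le_kn].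
  by have -> // : l = k; do 2 apply: val_inj; rewrite /= -/(level_nat l) nE -kE.
have /andP[k1 _] := level_bounds k; have /andP[_ lK] := level_bounds l.
have [|l' l'E] := @level_exists _ _ d n.
  by rewrite (leq_trans k1 le_kn) ltnW // -nE.
case: feas => _ mono _ _ _; apply: le_trans (mono l' l _) (IHn _ l'E le_kn).
by rewrite nE l'E.
Qed.

(** If u_k were 0, the covering constraint at (i, k) would demand alpha open
    facilities closer than d_k, because i itself is closed. *)
Lemma u_eq1 i (k : level d) :
  i \notin opened -> dist d (level_nat k) \in dists_from d i ->
  (#|[set j in opened | (d i j < dist d (level_nat k))%R]| < alpha)%N -> u k = 1.
Proof.
move=> iP kDi few; case: feas => _ _ cover ubin _; case: (ubin k) => // uk0.
have := cover i k kDi; rewrite uk0 y_opened (negbTE iP) subr0 mulr1 mulr0 add0r.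
rewrite sum_opened ler_nat leqNgt => /negP[]; apply: leq_ltn_trans few.
by apply: subset_leq_card; apply/subsetP=> j; rewrite !inE => /and3P[-> _ ->].
Qed.

(** The worst-served customer i of the opened set supplies the constraint;
    it is read at the level m of d_alpha, which is in D_i, and its conclusion
    is carried down to k <= m. *)
Lemma u_eq1_below_opt (k : level d) : (0 < alpha <= p)%N -> (p < #|N|)%N ->
  dist d (level_nat k) <= opt_value d p alpha -> u k = 1.
Proof.
case/andP=> alpha_gt0 le_ap lt_pN le_k_opt.
have [|i iP fE] := @f_alpha_attained _ _ d alpha opened.
  by rewrite card_opened.
have le_k_i : dist d (level_nat k) <= d_alpha d alpha opened i.
  apply: le_trans le_k_opt _; rewrite -fE; apply: seq_min_le.
  by apply: image_f; rewrite inE card_opened.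
have [|j jP dE] := @d_alpha_attained _ _ d _ opened alpha_gt0 i.
  by rewrite card_opened.
have ij : i != j by apply: contraNneq iP => ->.
have [m mK mE] := dist_attained d ij.
have /andP[k1 kK] := level_bounds k.
have le_km : (level_nat k <= m)%N.
  by rewrite -(@dist_le _ _ d) ?mE -?dE // ?kK ?(ltnW k1).
have m1 : (1 < m)%N := leq_trans k1 le_km.
have /andP[_ mK'] := mK.
have [|l lE] := @level_exists _ _ d m; first by rewrite m1.
have ul : u l = 1.
  apply: (u_eq1 iP); rewrite lE.
    rewrite inE mE image_f ?inE 1?[j == i]eq_sym //= -mE.
    by rewrite gt_eqF // ltNge dist_le -?ltnNge //= (leq_trans (ltnW m1) mK').
  by rewrite mE -dE card_closer_lt_alpha.
have := u_nonincreasing (k := k) (l := l); rewrite lE ul => /(_ le_km).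
by case: feas => _ _ _ /(_ k)[->|->] //; rewrite ler10.
Qed.

End Feasible.

Theorem theorem9 (R : realFieldType) (N : finType) (d : N -> N -> R)
    (p alpha : nat) (LB : R)
    (hd : forall i j : N, 0 <= d i j)
    (hp : (0 < p < #|N|)%N)
    (halpha : (0 < alpha <= p)%N)
    (hLB : LB <= opt_value d p alpha) :
  forall (u : {ffun level d -> R}) (y : {ffun N -> R}),
    (apc2_feasible p alpha u y
     /\ (forall k : level d, dist d (level_nat k) <= LB -> u k = 1))
    <-> apc2_feasible p alpha u y.
Proof.
move=> u y; split=> [[] //|feas]; split=> // k le_kLB.
case/andP: hp => _ lt_pN.
exact: (u_eq1_below_opt feas halpha lt_pN (le_trans le_kLB hLB)).
Qed.
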